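(* Let $N=m+n\to\infty$ with $m/N\to r\in(0,1)$, and let $G=G_N$ be a simple undirected graph on the nodes $\{1,\dots,N\}$ for each $N$. Suppose that, as $N\to\infty$, $\max_{1\le i\le N}\tilde d_i^{\,2}=o(V_G)$. Then, under the permutation null distribution, $Z_{\mathrm{diff}}^P$ converges in distribution to $N(0,1)$.
   Context: Graph notation. $G$ denotes both the graph on nodes $\{1,\dots,N\}$ (simple: no duplicate edges, no loops; undirected) and its edge set; $|\cdot|$ is cardinality, so $|G|$ is the number of edges. $G_i$ is the set of edges having node $i$ as an endpoint (so $|G_i|$ is the degree of $i$). $\tilde d_i=|G_i|-2|G|/N$ is the centered degree, $V_G=\sum_{i=1}^N\tilde d_i^{\,2}=\sum_{i=1}^N|G_i|^2-4|G|^2/N$. $a_N=o(b_N)$ means $\lim_{N\to\infty}a_N/b_N=0$. Permutation null distribution. The graph is fixed; the labels $(g_1,\dots,g_N)\in\{1,2\}^N$ are random: each choice of $m$ of the $N$ nodes to receive label $1$ (sample X), the remaining $n=N-m$ nodes receiving label $2$ (sample Y), has probability $1/\binom{N}{m}$. $\mathsf E_P$, $\mathsf{Var}_P$ denote expectation and variance under this distribution. Statistic. For $j=1,2$, $R_j$ is the number of edges of $G$ both of whose endpoints have label $j$. Let $$R_{\mathrm{diff}}=R_1-R_2,\qquad Z_{\mathrm{diff}}^P=\frac{R_{\mathrm{diff}}-\mathsf E_P(R_{\mathrm{diff}})}{\sqrt{\mathsf{Var}_P(R_{\mathrm{diff}})}}.$$ *)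

(* Defs.v *)
From HB Require Import structures.
From mathcomp Require Import all_boot all_order all_algebra.
From mathcomp Require Import all_classical all_reals all_analysis.

Set Implicit Arguments.
Unset Strict Implicit.
Unset Printing Implicit Defensive.

Import Order.TTheory GRing.Theory Num.Theory.
Import numFieldNormedType.Exports.

Local Open Scope ring_scope.

(* A graph on the nodes 'I_N is identified with its set of edges, an edge being
   the set of its endpoints.  Two-element sets exclude loops, and a set of edges
   excludes duplicates. *)
Definition simple_graph (N : nat) (G : {set {set 'I_N}}) : Prop :=
  forall e, e \in G -> #|e| = 2%N.

Definition edges_at (N : nat) (G : {set {set 'I_N}}) (i : 'I_N)
    : {set {set 'I_N}} :=
  [set e in G | i \in e].

Definition centered_degree (R : realType) (N : nat) (G : {set {set 'I_N}})
    (i : 'I_N) : R :=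
  #|edges_at G i|%:R - 2 * #|G|%:R / N%:R.

Definition VG (R : realType) (N : nat) (G : {set {set 'I_N}}) : R :=
  \sum_(i < N) centered_degree R G i ^+ 2.

(* The default value 0 only matters for N = 0, all terms being nonnegative. *)
Definition max_sq_centered_degree (R : realType) (N : nat)
    (G : {set {set 'I_N}}) : R :=
  \big[Num.max/0]_(i < N) (centered_degree R G i ^+ 2).

(* a N / b N --> 0.  Since x / 0 = 0, the quotient has to be required to make
   sense for large N; this also rules out a = b = 0, which Landau's =o of the
   library accepts. *)
Definition ratio_littleo (R : realType) (a b : nat -> R) : Prop :=
  ((\forall N \near \oo, b N != 0) /\ a N / b N @[N --> \oo] --> (0 : R))%classic.

(* [true] is label 1 (sample X), [false] is label 2 (sample Y). *)
Definition labelling (N : nat) := {ffun 'I_N -> bool}.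

HB.instance Definition _ (N : nat) := Finite.on (labelling N).
HB.instance Definition _ (N : nat) :=
  isPointed.Build (labelling N) [ffun=> false].
HB.instance Definition _ (N : nat) := @isMeasurable.Build
  default_measure_display (labelling N) discrete_measurable
  discrete_measurable0 discrete_measurableC discrete_measurableU.

Definition choices (N m : nat) : {set labelling N} :=
  [set g : labelling N | #|[set i | g i]| == m].

Lemma card_choices (N m : nat) : #|choices N m| = 'C(N, m).
Proof.
rewrite -[in RHS](card_ord N) -card_draws.
rewrite -(card_imset _ (f := fun A : {set 'I_N} => [ffun i => i \in A])); last first.
  by move=> A B /ffunP AB; apply/setP => i; have := AB i; rewrite !ffunE.
apply: eq_card => g; rewrite inE; apply/idP/imsetP => [gm|[A]].
  exists [set i | g i]; first by rewrite inE.
  by apply/ffunP => i; rewrite ffunE inE.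
rewrite inE => Am ->; rewrite (_ : [set i | _] = A)//.
by apply/setP => i; rewrite inE ffunE.
Qed.

(* The hypothesis m <= N is what makes this a probability. *)
Definition perm_null (R : realType) (N m : nat) of (m <= N)%N
    : set (labelling N) -> \bar R :=
  fun A => (\sum_(g in choices N m) ('C(N, m)%:R^-1)%:E * \d_g A)%E.

Section perm_null_probability.
Context (R : realType) (N m : nat) (le_mN : (m <= N)%N).
Local Notation P := (perm_null R le_mN).

Let perm_null0 : P set0 = 0%E.
Proof. by rewrite /P big1// => g _; rewrite measure0 mule0. Qed.

Let perm_null_ge0 A : (0 <= P A)%E.
Proof.
by apply: sume_ge0 => g _; rewrite mule_ge0// lee_fin invr_ge0.
Qed.

Let perm_null_sigma_additive : semi_sigma_additive P.
Proof.
move=> F mF tF mUF.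
pose c : {nonneg R} := NngNum (eqbRL (invr_ge0 'C(N, m)%:R) (ler0n R _)).
have PE A : P A = (\sum_(g in choices N m) mscale c \d_g A)%E by [].
rewrite [X in (_ --> X)%classic](_ : _ =
    limn (fun n => (\sum_(0 <= i < n) P (F i))%E)).
  by apply: is_cvg_ereal_nneg_natsum.
rewrite PE.
under [in RHS]eq_fun do under eq_bigr do rewrite PE.
rewrite nneseries_sum//; apply: eq_bigr => g _.
exact: measure_semi_bigcup.
Qed.

HB.instance Definition _ := isMeasure.Build _ _ _ P
  perm_null0 perm_null_ge0 perm_null_sigma_additive.

Let perm_null_setT : P [set: labelling N]%classic = 1%E.
Proof.
rewrite /perm_null.
under eq_bigr do rewrite diracT mule1.
rewrite sumEFin sumr_const card_choices -[_ *+ _]mulr_natl divff//.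
by rewrite pnatr_eq0 -lt0n bin_gt0.
Qed.

HB.instance Definition _ := Measure_isProbability.Build _ _ _ P perm_null_setT.

End perm_null_probability.

(* R_1 is [edges_within G true], R_2 is [edges_within G false]. *)
Definition edges_within (N : nat) (G : {set {set 'I_N}}) (j : bool)
    (g : labelling N) : nat :=
  #|[set e in G | [forall i in e, g i == j]]|.

Definition Rdiff (R : realType) (N : nat) (G : {set {set 'I_N}})
    (g : labelling N) : R :=
  (edges_within G true g)%:R - (edges_within G false g)%:R.

Definition Zdiff (R : realType) (N m : nat) (le_mN : (m <= N)%N)
    (G : {set {set 'I_N}}) (g : labelling N) : R :=
  (Rdiff R G g - fine 'E_(perm_null R le_mN)[Rdiff R G])
  / Num.sqrt (fine 'V_(perm_null R le_mN)[Rdiff R G]).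

Section Zdiff_measurable.
Context (R : realType) (N m : nat) (le_mN : (m <= N)%N) (G : {set {set 'I_N}}).

Let measurable_Zdiff : measurable_fun [set: _]%classic (Zdiff R le_mN G).
Proof. by []. Qed.

HB.instance Definition _ := isMeasurableFun.Build _ _ _ _ (Zdiff R le_mN G)
  measurable_Zdiff.

End Zdiff_measurable.

Definition cvg_in_distribution (R : realType) (d : nat -> measure_display)
    (T : forall N, measurableType (d N)) (P : forall N, probability (T N) R)
    (X : forall N, {RV (P N) >-> R}) 
    (mu : probability (measurableTypeR R) R) : Prop :=
  forall x : R, {for x, continuous (fun y : R => mu `]-oo, y]%classic)} ->
    (cdf (X N) x @[N --> \oo] --> mu `]-oo, x])%classic.

(* Main.v *)
From HB Require Import structures.
Require Import Defs.
From mathcomp Require Import all_boot all_order all_algebra perm.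
From mathcomp Require Import all_classical all_reals all_analysis.
From mathcomp Require Import measurable_realfun ring lra.

(** An edge with endpoints [i] and [j] contributes [g i + g j - 1] to [R_1 - R_2]
    when labels are counted as 1 (sample X) and 0 (sample Y). Therefore [R_diff] is,
    up to a constant, the sum of the degrees of the nodes of sample X, and
    [Z_diff] is the standardized sum of the centered degrees over a simple random
    sample of [m] nodes out of [N] ([Zdiff_sample_sum]). The theorem is thus a
    central limit theorem for sampling without replacement
    ([finite_population_clt]), under the condition that the largest weight is
    negligible; it is proved by Stein's method.

    Let [W] be the sum over the sample of weights [a i] with total 0, scaled to
    variance 1. Exchanging the labels of a sampled node [i] and an unsampled node
    [j] preserves the distribution and changes [W] by [a j - a i]. This gives an
    exact formula for the mean of [W * f W] as the mean of a sum of differences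
    of [f] ([mean_sample_sum_mul]). A Taylor expansion of the differences shows that
    the mean of [f' W - W * f W] is small ([stein_bound]): the cubic remainder is
    controlled by the largest weight, and the coefficient of [f' W] is a random
    variable of mean 1 that is itself concentrated, because it involves only [W ^+ 2]
    and the sampling sum of the [a i ^+ 2].

    The normal distribution enters through Stein's equation
    [f' w - w * f w = h w - c], where [c] is the normal mean of [h]. For [h] a
    piecewise linear approximation of the indicator of a half-line, bounds on
    Mills' ratio give a solution with bounded and Lipschitz derivative
    ([stein_solution]). The distribution function of [W] is then squeezed between
    values of the normal one at nearby points. *)

Set Implicit Arguments.
Unset Strict Implicit.
Import Order.TTheory GRing.Theory Num.Theory.
Import numFieldNormedType.Exports.
Local Open Scope classical_set_scope.
Local Open Scope ring_scope.

(** * Real functions of one variable *)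

Section Calculus.
Variable R : realType.
Implicit Types (f g df : R -> R).

Lemma is_derive_continuous f df :
  (forall x : R, is_derive x 1 f (df x)) -> continuous f.
Proof.
by move=> fdf x; apply/differentiable_continuous/derivable1_diffP; exact: ex_derive.
Qed.

Lemma MVT_real f df : (forall x : R, is_derive x 1 f (df x)) ->
  forall x y, exists2 c, `|c - x| <= `|y - x| & f y - f x = df c * (y - x).
Proof.
move=> fdf.
have inc x y : x <= y -> exists2 c, x <= c <= y & f y - f x = df c * (y - x).
  move=> xy; have [|c cxy fc] := @MVT_segment _ f df _ _ xy (fun z _ => fdf z).
    by apply: continuous_subspaceT; exact: is_derive_continuous fdf.
  by exists c => //; rewrite in_itv/= in cxy.
move=> x y; have [xy|/ltW yx] := leP x y.
  have [c /andP[xc cy] fc] := inc x y xy; exists c => //.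
  by rewrite !ger0_norm ?subr_ge0// lerD2r.
have [c /andP[yc cx] fc] := inc y x yx; exists c.
  by rewrite !ler0_norm ?subr_le0// lerN2 lerD2r.
by rewrite -(opprB (f x)) fc; ring.
Qed.

Lemma lipschitz_of_derive f df (C : R) :
  (forall x : R, is_derive x 1 f (df x)) -> (forall x, `|df x| <= C) ->
  forall x y, `|f x - f y| <= C * `|x - y|.
Proof.
move=> fdf dfC x y; have [c _ ->] := MVT_real fdf y x.
by rewrite normrM ler_wpM2r.
Qed.

(** The mean value theorem puts the slope of the chord at a point within [`|d|]
    of [x], where the derivative differs by at most [K * `|d|]. *)
Lemma lipschitz_taylor f df (K : R) :
  (forall x : R, is_derive x 1 f (df x)) ->
  (forall x y, `|df x - df y| <= K * `|x - y|) ->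
  forall x d, `|f x - f (x - d) - d * df x| <= K * d ^+ 2.
Proof.
move=> fdf dfK x d; have K0 : 0 <= K.
  by have := dfK 1 0; rewrite subr0 normr1 mulr1; exact: le_trans.
have [c] := MVT_real fdf x (x - d).
rewrite (_ : x - d - x = - d); last by ring.
rewrite normrN => cd fc.
rewrite (_ : _ - _ = d * (df c - df x)); last by rewrite -(opprB (f _)) fc; ring.
rewrite normrM; apply: (@le_trans _ _ (`|d| * (K * `|c - x|))).
  by rewrite ler_wpM2l.
rewrite mulrCA ler_wpM2l// -[d ^+ 2]real_normK ?num_real// expr2.
by rewrite ler_wpM2l.
Qed.

Lemma continuous_bounded g (a b C : R) : continuous g ->
  (forall x, x <= a -> `|g x| <= C) -> (forall x, b <= x -> `|g x| <= C) ->
  exists C', forall x, `|g x| <= C'.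
Proof.
move=> cg ga gb; have [ba|ab] := leP b a.
  exists C => x; have [xa|ax] := leP x a; first exact: ga.
  by apply: gb; rewrite (le_trans ba)// ltW.
have [|c _ gc] := @EVT_max R (fun x => `|g x|) a b (ltW ab).
  apply: continuous_subspaceT => x; apply: continuous_comp; first exact: cg.
  exact: norm_continuous.
exists (Num.max C `|g c|) => x; rewrite le_max.
have [xa|ax] := leP x a; first by rewrite ga.
have [bx|xb] := leP b x; first by rewrite gb.
by apply/orP; right; apply: gc; rewrite in_itv/= !ltW.
Qed.

(** A nondecreasing function stays above its limit at [-oo]. *)
Lemma ge0_of_derive_Ny g dg (b : R) :
  (forall x : R, x < b -> is_derive x 1 g (dg x)) ->
  (forall x, x < b -> 0 <= dg x) -> g x @[x --> -oo] --> (0 : R) ->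
  forall x, x < b -> 0 <= g x.
Proof.
move=> gdg dg0 g0 x xb; rewrite -(cvg_lim (@Rhausdorff R) g0).
apply: limr_le; first by apply/cvg_ex; exists 0.
near=> y; have yx : y <= x by near: y; apply: nbhs_ninfty_le; exact: num_real.
have [||c + gc] := @MVT_segment _ g dg _ _ yx.
- by move=> z; rewrite in_itv/= => /andP[_ zx]; apply: gdg; exact: lt_trans zx xb.
- apply: derivable_within_continuous => z; rewrite in_itv/= => /andP[_ zx].
  by have ? := gdg z (le_lt_trans zx xb); exact: ex_derive.
rewrite in_itv/= => /andP[_ cx].
rewrite -subr_ge0 gc mulr_ge0// ?subr_ge0//; apply: dg0; exact: le_lt_trans xb.
Unshelve. all: by end_near. Qed.

End Calculus.

(** * Simple random sampling and its exchangeable pair *)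

Section Sampling.
Variables (R : realType) (N m : nat).
Implicit Types (F : labelling N -> R) (g : labelling N) (a : 'I_N -> R).

Definition mean F : R := 'C(N, m)%:R^-1 * \sum_(g in choices N m) F g.

Lemma eq_mean F1 F2 : {in choices N m, F1 =1 F2} -> mean F1 = mean F2.
Proof. by move=> F12; congr (_ * _); apply: eq_bigr. Qed.

Lemma le_mean F1 F2 : {in choices N m, forall g, F1 g <= F2 g} ->
  mean F1 <= mean F2.
Proof.
by move=> F12; rewrite ler_wpM2l ?invr_ge0 ?ler0n//; exact: ler_sum.
Qed.

Lemma meanD F1 F2 : mean (fun g => F1 g + F2 g) = mean F1 + mean F2.
Proof. by rewrite /mean big_split mulrDr. Qed.

Lemma meanZ c F : mean (fun g => c * F g) = c * mean F.
Proof. by rewrite /mean -mulr_sumr mulrCA. Qed.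

Lemma meanN F : mean (fun g => - F g) = - mean F.
Proof. by rewrite /mean sumrN mulrN. Qed.

Lemma meanB F1 F2 : mean (fun g => F1 g - F2 g) = mean F1 - mean F2.
Proof. by rewrite meanD meanN. Qed.

Lemma mean_sum (I : finType) (F : I -> labelling N -> R) :
  mean (fun g => \sum_i F i g) = \sum_i mean (F i).
Proof. by rewrite /mean exchange_big/= mulr_sumr. Qed.

Lemma ler_norm_mean F : `|mean F| <= mean (fun g => `|F g|).
Proof.
rewrite normrM ger0_norm ?invr_ge0 ?ler0n// ler_wpM2l ?invr_ge0 ?ler0n//.
exact: ler_norm_sum.
Qed.

Lemma mean_cst (c : R) : (m <= N)%N -> mean (fun=> c) = c.
Proof.
move=> le_mN; rewrite /mean sumr_const card_choices -(mulr_natl c) mulrA.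
by rewrite mulVf ?mul1r// pnatr_eq0 -lt0n bin_gt0.
Qed.

Definition swap (i j : 'I_N) g : labelling N := [ffun k => g (tperm i j k)].

Lemma swapK i j : involutive (swap i j).
Proof. by move=> g; apply/ffunP => k; rewrite !ffunE tpermK. Qed.

Lemma swap_choices i j g : (swap i j g \in choices N m) = (g \in choices N m).
Proof.
rewrite !inE; congr (_ == _); rewrite -(card_imset _ (@perm_inj _ (tperm i j))).
apply: eq_card => k; rewrite inE; apply/imsetP/idP => [[l]|gk].
  by rewrite inE ffunE => gl ->.
by exists (tperm i j k); rewrite ?inE ?ffunE tpermK.
Qed.

Lemma mean_swap i j F : mean (fun g => F (swap i j g)) = mean F.
Proof.
congr (_ * _); rewrite [RHS](reindex_inj (inv_inj (swapK i j))).
by apply: eq_bigl => g; rewrite swap_choices.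
Qed.

Definition sample_sum a g : R := \sum_i a i * (g i)%:R.

Definition split_at (i j : 'I_N) g : R := (g i && ~~ g j)%:R.

Lemma split_atE i j g : split_at i j g = (g i)%:R * (1 - (g j)%:R).
Proof. by rewrite /split_at; case: (g i); case: (g j); rewrite /=; ring. Qed.

Lemma choices_sum g : g \in choices N m -> \sum_i (g i)%:R = m%:R :> R.
Proof.
rewrite inE => /eqP <-; rewrite -sum1_card natr_sum.
by rewrite [RHS]big_mkcond; apply: eq_bigr => i _; rewrite inE; case: (g i).
Qed.

Lemma sample_sum_swap a i j g : g i -> ~~ g j ->
  sample_sum a (swap i j g) = sample_sum a g - (a i - a j).
Proof.
move=> gi gj; have ij : j != i by apply: contraNneq gj => ->.
rewrite /sample_sum (bigD1 i)//= (bigD1 j)//= [in RHS](bigD1 i)//=.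
rewrite [X in _ = a i * _ + X - _](bigD1 j)//= !ffunE tpermL tpermR gi (negbTE gj).
rewrite [in LHS](eq_bigr (fun k => a k * (g k)%:R)); first by rewrite /=; ring.
by move=> k /andP[ki kj]; rewrite ffunE tpermD// eq_sym.
Qed.

(** Terms with both nodes sampled cancel by antisymmetry, and summing [a j] over
    all [j] gives zero. *)
Lemma sample_sum_split a g : \sum_i a i = 0 ->
  N%:R * sample_sum a g = \sum_i \sum_j (a i - a j) * split_at i j g.
Proof.
move=> a0; set s := \sum_i (g i)%:R : R; set W := sample_sum a g.
transitivity (\sum_i (a i * (g i)%:R * (N%:R - s) + (g i)%:R * W)).
  by rewrite big_split/= -!mulr_suml -/(sample_sum a g) -/s -/W; ring.
apply: eq_bigr => i _.
transitivity (\sum_j (a i * (g i)%:R * (1 - (g j)%:R)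
                      + ((g i)%:R * (a j * (g j)%:R) - (g i)%:R * a j))).
  rewrite big_split sumrB -!mulr_sumr sumrB/= a0 mulr0 subr0.
  by rewrite sumr_const card_ord -/(sample_sum a g).
by apply: eq_bigr => j _; rewrite split_atE; ring.
Qed.

(** The probability that a fixed node is sampled and another fixed node is not. *)
Definition pair_rate : R := m%:R * (N%:R - m%:R) / (N%:R * (N%:R - 1)).

Hypotheses (N2 : (1 < N)%N) (le_mN : (m <= N)%N).

(** Swaps make the value common to all pairs of distinct nodes; the total over
    all pairs is the number of sampled times the number of unsampled nodes. *)
Lemma mean_split_at i j : i != j -> mean (split_at i j) = pair_rate.
Proof.
move=> ij.
have N0 : N%:R != 0 :> R by rewrite pnatr_eq0; case: (N) N2.
have N10 : N%:R - 1 != 0 :> R by rewrite subr_eq0 pnatr_eq1; case: (N) N2 => [|[]].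
have sw k l k' : k != l -> k' != l -> mean (split_at k l) = mean (split_at k' l).
  move=> kl kl'; rewrite -(mean_swap k k' (split_at k l)); apply: eq_mean => g _.
  by rewrite /split_at !ffunE tpermL tpermD.
have sw2 k l l' : k != l -> k != l' -> mean (split_at k l) = mean (split_at k l').
  move=> kl kl'; rewrite -(mean_swap l l' (split_at k l)); apply: eq_mean => g _.
  by rewrite /split_at !ffunE tpermL tpermD// eq_sym.
have cst k l : k != l -> mean (split_at k l) = mean (split_at i j).
  move=> kl; have [ki|ki] := eqVneq k j.
    have [li|li] := eqVneq l i; last first.
      by rewrite (sw k l i)// 1?eq_sym// (sw2 i l j)// eq_sym.
    rewrite ki li => {ki li k l kl}.
    rewrite -(mean_swap i j); apply: eq_mean => g _.
    by rewrite /split_at !ffunE tpermL tpermR.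
  by rewrite (sw2 k l j)// (sw k j i).
have tot : \sum_k \sum_l mean (split_at k l) = m%:R * (N%:R - m%:R).
  under eq_bigr do rewrite -mean_sum.
  rewrite -mean_sum -[RHS](mean_cst _ le_mN); apply: eq_mean => g gm.
  under eq_bigr => k _ do under eq_bigr => l _ do rewrite split_atE.
  under eq_bigr => k _ do rewrite -mulr_sumr sumrB sumr_const card_ord (choices_sum gm).
  by rewrite -mulr_suml (choices_sum gm).
apply: (mulfI (mulf_neq0 N0 N10)).
rewrite /pair_rate [RHS]mulrC divfK ?mulf_neq0// -tot.
transitivity (\sum_(k < N) (N%:R - 1) * mean (split_at i j)).
  by rewrite sumr_const card_ord -[RHS]mulr_natl mulrA.
apply: eq_bigr => k _; rewrite (bigD1 k)//= [mean (split_at k k)](_ : _ = 0).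
  rewrite add0r (eq_bigr (fun=> mean (split_at i j))); last first.
    by move=> l lk; rewrite cst// eq_sym.
  rewrite sumr_const cardC1 card_ord -[RHS]mulr_natl; congr (_ * _).
  by rewrite -subn1 natrB// ltnW.
rewrite (_ : split_at k k = fun=> 0) ?mean_cst//.
by apply/funext => g; rewrite /split_at andbN.
Qed.

(** The exchangeable pair identity. By [sample_sum_split], [N * W] is a sum over
    ordered pairs [(i, j)] with [i] sampled and [j] not. Exchanging the labels of
    [i] and [j] preserves the distribution of the labels, replaces [W] by
    [W - (a i - a j)] and turns the pair [(j, i)] into [(i, j)] with the opposite
    sign; averaging the two forms of the sum produces a difference of [f]. *)
Lemma mean_sample_sum_mul a (f : R -> R) : \sum_i a i = 0 ->
  mean (fun g => sample_sum a g * f (sample_sum a g)) =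
  mean (fun g => (2 * N%:R)^-1 * \sum_i \sum_j (a i - a j) * split_at i j g *
    (f (sample_sum a g) - f (sample_sum a g - (a i - a j)))).
Proof.
move=> a0; set W := sample_sum a.
have N0 : N%:R != 0 :> R by rewrite pnatr_eq0; case: (N) N2.
pose T i j := mean (fun g => (a i - a j) * split_at i j g * f (W g)).
pose T' i j := mean (fun g => (a i - a j) * split_at i j g * f (W g - (a i - a j))).
have TT' i j : T i j = - T' j i.
  rewrite /T -(mean_swap i j) -meanN; apply: eq_mean => g _.
  rewrite /split_at !ffunE tpermL tpermR.
  case: (boolP (g j && ~~ g i)) => [/andP[gj gi]|_]; last by rewrite /=; ring.
  rewrite (_ : W (swap i j g) = W g - (a j - a i)); first by rewrite /=; ring.
  rewrite -sample_sum_swap//; congr sample_sum.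
  by apply/ffunP => k; rewrite !ffunE tpermC.
have sumT : N%:R * mean (fun g => W g * f (W g)) = \sum_i \sum_j T i j.
  rewrite -meanZ; under [RHS]eq_bigr do rewrite -mean_sum.
  rewrite -mean_sum; apply: eq_mean => g _.
  by rewrite mulrA sample_sum_split// mulr_suml; under eq_bigr do rewrite mulr_suml.
have sumT' : \sum_i \sum_j T i j = - \sum_i \sum_j T' i j.
  rewrite exchange_big/= -sumrN; apply: eq_bigr => i _.
  by rewrite -sumrN; apply: eq_bigr.
rewrite meanZ mean_sum; under [in RHS]eq_bigr do rewrite mean_sum.
rewrite [X in _ = _ * X](_ : _ = \sum_i \sum_j T i j - \sum_i \sum_j T' i j).
  by rewrite -[X in _ * (_ + X)]sumT' -sumT; field.
rewrite -sumrB; apply: eq_bigr => i _; rewrite -sumrB; apply: eq_bigr => j _.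
by rewrite -meanB; apply: eq_mean => g _; rewrite mulrBr.
Qed.

(** Let [W'] be obtained from [W] by swapping the labels of a uniformly chosen
    ordered pair of nodes. For weights of total 0, [W' - W] has conditional mean
    [- (2 / N) * W] given the labels; this is the conditional mean of
    [(W' - W) ^+ 2] divided by twice the rate [2 / N]. It is the coefficient of [f' W] in the first-order expansion of
    [mean_sample_sum_mul]. *)
Definition half_square_jump a g : R :=
  (2 * N%:R)^-1 * \sum_i \sum_j (a i - a j) ^+ 2 * split_at i j g.

Lemma mean_half_square_jump a : \sum_i a i = 0 ->
  mean (half_square_jump a) = pair_rate * \sum_i a i ^+ 2.
Proof.
move=> a0; have N0 : N%:R != 0 :> R by rewrite pnatr_eq0; case: (N) N2.
rewrite meanZ mean_sum.
transitivity ((2 * N%:R)^-1 * \sum_i \sum_j (pair_rate * (a i - a j) ^+ 2)).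
  congr (_ * _); apply: eq_bigr => i _; rewrite mean_sum; apply: eq_bigr => j _.
  rewrite meanZ; have [->|ij] := eqVneq i j; first by rewrite subrr expr0n/= !Monoid.simpm.
  by rewrite mean_split_at// mulrC.
under eq_bigr do rewrite -mulr_sumr.
rewrite -mulr_sumr (_ : \sum_i _ = 2 * N%:R * \sum_i a i ^+ 2); first by field.
transitivity (\sum_i (N%:R * a i ^+ 2 + \sum_j a j ^+ 2)).
  apply: eq_bigr => i _.
  transitivity (\sum_j (a i ^+ 2 + a j ^+ 2 + (-2) * a i * a j)).
    by apply: eq_bigr => j _; ring.
  rewrite !big_split/= sumr_const card_ord -[X in _ + X]mulr_sumr a0 mulr0 addr0.
  by rewrite -[_ *+ N]mulr_natl.
rewrite big_split/= -mulr_sumr sumr_const card_ord -[_ *+ N]mulr_natl; ring.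
Qed.

(** The exchangeable pair identity for the identity function. *)
Lemma mean_sample_sum_sq a : \sum_i a i = 0 ->
  mean (fun g => sample_sum a g ^+ 2) = pair_rate * \sum_i a i ^+ 2.
Proof.
move=> a0; rewrite -mean_half_square_jump//.
rewrite -(@eq_mean (fun g => sample_sum a g * idfun (sample_sum a g)))//.
rewrite mean_sample_sum_mul//; apply: eq_mean => g _; congr (_ * _).
by apply: eq_bigr => i _; apply: eq_bigr => j _ /=; ring.
Qed.

(** Expanding the square leaves only the linear sum of the [a i ^+ 2] and the
    square of [W]: the fluctuations of the left-hand side come from these two. *)
Lemma half_square_jumpE a g : \sum_i a i = 0 -> g \in choices N m ->
  half_square_jump a g = (2 * N%:R)^-1 *
    (m%:R * (\sum_i a i ^+ 2) + (N%:R - 2 * m%:R) * sample_sum (fun i => a i ^+ 2) g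
     + 2 * sample_sum a g ^+ 2).
Proof.
move=> a0 gm; congr (_ * _); set A := \sum_i a i ^+ 2.
set S := sample_sum _ g; set W := sample_sum a g.
transitivity (\sum_i ((a i ^+ 2 * (g i)%:R) * (N%:R - m%:R) + (g i)%:R * (A - S)
                      + (a i * (g i)%:R) * (2 * W))).
  apply: eq_bigr => i _.
  transitivity (\sum_j (a i ^+ 2 * (g i)%:R * (1 - (g j)%:R)
     + (g i)%:R * (a j ^+ 2 - a j ^+ 2 * (g j)%:R)
     + a i * (g i)%:R * (2 * (a j * (g j)%:R)) + (- 2 * a i * (g i)%:R) * a j)).
    by apply: eq_bigr => j _; rewrite split_atE; ring.
  rewrite !big_split/= -!mulr_sumr a0 mulr0 addr0 !sumrB sumr_const card_ord.
  by rewrite (choices_sum gm).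
rewrite !big_split/= -!mulr_suml (choices_sum gm).
by rewrite -/(sample_sum a g) -/(sample_sum (fun i => a i ^+ 2) g) -/S -/W; ring.
Qed.
End Sampling.

(** * Stein's bound for a standardized sampling sum *)

Section SteinBound.
Variables (R : realType) (N m : nat).
Implicit Types (g : labelling N) (a : 'I_N -> R).
Hypotheses (N2 : (1 < N)%N) (le_mN : (m <= N)%N).
Local Notation mean := (@mean R N m).
Local Notation rate := (pair_rate R N m).

Lemma pair_rate_ge0 : 0 <= rate.
Proof.
rewrite /pair_rate divr_ge0// mulr_ge0 ?ler0n ?subr_ge0 ?ler_nat// ler1n.
exact: ltnW.
Qed.

Variables (a : 'I_N -> R) (eta : R).
Hypotheses (suma0 : \sum_i a i = 0) (var1 : rate * \sum_i a i ^+ 2 = 1).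
Hypotheses (eta0 : 0 < eta) (a_le : forall i, `|a i| <= eta).
Local Notation W := (sample_sum a).
Local Notation Q := (half_square_jump a).

(** Up to the factor [(2 * N)^-1], the difference is [N - 2 m] times a centered
    sampling sum with weights [a i ^+ 2], of variance at most [eta ^+ 2], plus
    twice [W ^+ 2 - 1], of mean absolute value at most 2. *)
Lemma mean_half_square_jump_sub1 :
  mean (fun g => `|Q g - 1|) <= eta / 2 + 2 / N%:R.
Proof.
have N0 : N%:R != 0 :> R by rewrite pnatr_eq0; case: (N) N2.
have N10 : N%:R - 1 != 0 :> R by rewrite subr_eq0 pnatr_eq1; case: (N) N2 => [|[]].
have Npos : 0 < N%:R :> R by rewrite lt0r N0/=.
set A := \sum_i a i ^+ 2; set b := fun i => a i ^+ 2 - A / N%:R.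
have b0 : \sum_i b i = 0.
  by rewrite sumrB sumr_const card_ord -/A -[_ *+ N]mulr_natr divfK ?subrr.
have varb : mean (fun g => sample_sum b g ^+ 2) <= eta ^+ 2.
  rewrite mean_sample_sum_sq//; apply: (@le_trans _ _ (rate * (eta ^+ 2 * A))).
    rewrite ler_wpM2l ?pair_rate_ge0//.
    apply: (@le_trans _ _ (\sum_i a i ^+ 2 ^+ 2)).
      rewrite -subr_ge0 -sumrB.
      rewrite (eq_bigr (fun i => 2 * (A / N%:R) * a i ^+ 2 - (A / N%:R) ^+ 2)).
        rewrite sumrB -mulr_sumr -/A sumr_const card_ord -[_ *+ N]mulr_natr.
        rewrite (_ : _ - _ = A ^+ 2 / N%:R); last by field.
        by rewrite divr_ge0 ?sqr_ge0 ?ltW.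
      by move=> i _; rewrite /b; ring.
    rewrite mulr_sumr; apply: ler_sum => i _; rewrite [leLHS]expr2.
    rewrite ler_wpM2r ?sqr_ge0// -real_normK ?num_real// ler_pXn2r ?nnegrE//.
    exact: ltW.
  by rewrite mulrCA var1 mulr1.
have varW : mean (fun g => W g ^+ 2) = 1 by rewrite mean_sample_sum_sq.
have Q1 g : g \in choices N m -> Q g - 1 =
    (2 * N%:R)^-1 * ((N%:R - 2 * m%:R) * sample_sum b g + 2 * (W g ^+ 2 - 1)).
  move=> gm; rewrite (half_square_jumpE _ gm)//.
  have -> : sample_sum b g = sample_sum (fun i => a i ^+ 2) g - A / N%:R * m%:R.
    rewrite -(choices_sum R gm) mulr_sumr -sumrB.
    by apply: eq_bigr => i _; rewrite mulrBl.
  move: var1; rewrite /pair_rate -/A => v.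
  have {}v : m%:R * (N%:R - m%:R) * A = N%:R * (N%:R - 1).
    by rewrite -[RHS]mulr1 -v; field; rewrite N0 N10.
  apply/eqP; rewrite -subr_eq0; apply/eqP.
  transitivity (((m%:R * (N%:R - m%:R) * A) - N%:R * (N%:R - 1)) / N%:R ^+ 2).
    by field; rewrite N0.
  by rewrite v subrr mul0r.
apply: (@le_trans _ _ (mean (fun g =>
    (4 * eta)^-1 * sample_sum b g ^+ 2 + (N%:R^-1 * W g ^+ 2
    + (eta / 4 + N%:R^-1))))).
  apply: le_mean => g gm; rewrite Q1//.
  rewrite normrM ger0_norm ?invr_ge0 ?mulr_ge0//.
  set S := sample_sum _ _; set w := W g.
  (* arithmetic-geometric mean, balanced for a variance [eta ^+ 2] *)
  have hS : `|S| <= (2 * eta)^-1 * S ^+ 2 + eta / 2.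
    rewrite -subr_ge0 -[S ^+ 2]real_normK ?num_real//.
    rewrite (_ : _ - _ = (2 * eta)^-1 * (`|S| - eta) ^+ 2).
      by rewrite mulr_ge0 ?sqr_ge0// invr_ge0 mulr_ge0// ltW.
    by field; rewrite gt_eqF.
  have hm : `|N%:R - 2 * m%:R| <= N%:R :> R.
    have : (m%:R <= N%:R :> R) by rewrite ler_nat.
    have : (0 <= m%:R :> R) by [].
    by rewrite ler_norml; lra.
  apply: (@le_trans _ _ ((2 * N%:R)^-1 * (N%:R * ((2 * eta)^-1 * S ^+ 2 + eta / 2)
      + 2 * (w ^+ 2 + 1)))).
    rewrite ler_wpM2l ?invr_ge0 ?mulr_ge0//.
    rewrite (le_trans (ler_normD _ _))// lerD//.
      by rewrite normrM ler_pM.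
    rewrite normrM ger0_norm// ler_wpM2l// ler_norml.
    have := sqr_ge0 w; lra.
  by rewrite le_eqVlt; apply/predU1P; left; field; rewrite N0 gt_eqF.
rewrite meanD meanZ meanD meanZ varW mean_cst//.
apply: (@le_trans _ _ ((4 * eta)^-1 * eta ^+ 2 + (N%:R^-1 * 1 + (eta / 4 + N%:R^-1)))).
  by rewrite lerD2r ler_wpM2l// invr_ge0 mulr_ge0// ltW.
by rewrite le_eqVlt; apply/predU1P; left; field; rewrite N0 gt_eqF.
Qed.

(** In [mean_sample_sum_mul], replace each difference of [f] by its first-order
    term: the total is then [half_square_jump] times [f' W], and the error per
    pair is cubic in [a i - a j], which is at most [2 * eta] in absolute value.
    Then replace [half_square_jump] by its mean 1. *)
Lemma stein_bound (f df : R -> R) (B K : R) :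
  (forall x : R, is_derive x 1 f (df x)) -> (forall x, `|df x| <= B) ->
  (forall x y, `|df x - df y| <= K * `|x - y|) ->
  `|mean (fun g => df (W g) - W g * f (W g))| <=
    B * (eta / 2 + 2 / N%:R) + 2 * K * eta.
Proof.
move=> fdf dfB dfK.
have K0 : 0 <= K.
  have := dfK 1 0; rewrite subr0 normr1 mulr1; exact: le_trans.
have N0 : 0 < N%:R :> R by rewrite ltr0n; case: (N) N2.
rewrite meanB mean_sample_sum_mul//.
set J := mean (fun g => _ * _).
rewrite (_ : _ - _ = mean (fun g => (1 - Q g) * df (W g)) +
   (mean (fun g => Q g * df (W g)) - J)); last first.
  by rewrite addrA -meanD; congr (_ - _); apply: eq_mean => g _; ring.
apply: (le_trans (ler_normD _ _)); apply: lerD.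
  apply: (le_trans (ler_norm_mean _ _)).
  apply: (le_trans (@le_mean _ _ _ _ (fun g => B * `|Q g - 1|) _)).
    by move=> g _; rewrite normrM distrC mulrC ler_wpM2r.
  rewrite meanZ ler_wpM2l ?mean_half_square_jump_sub1//.
  exact: le_trans (dfB 0).
rewrite -meanB; apply: (le_trans (ler_norm_mean _ _)).
have -> : 2 * K * eta = mean (fun g => 2 * K * eta * Q g).
  by rewrite meanZ mean_half_square_jump// var1 mulr1.
apply: le_mean => g _; rewrite /half_square_jump.
set u := (2 * N%:R)^-1; have u0 : 0 <= u by rewrite invr_ge0 mulr_ge0// ltW.
rewrite -[X in `|X - _|]mulrA -mulrBr normrM ger0_norm// [leRHS]mulrCA ler_wpM2l//.
rewrite mulr_suml -sumrB mulr_sumr (le_trans (ler_norm_sum _ _ _))//.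
apply: ler_sum => i _.
rewrite mulr_suml -sumrB mulr_sumr (le_trans (ler_norm_sum _ _ _))//.
apply: ler_sum => j _; set d := a i - a j; set x := split_at _ _ _ _.
have x0 : 0 <= x by rewrite /x /split_at; case: (_ && _).
have d2 : `|d| <= 2 * eta.
  by rewrite (le_trans (ler_normB _ _))// mulr2n mulrDl mul1r lerD.
rewrite (_ : _ - _ = - (x * d * (f (W g) - f (W g - d) - d * df (W g)))); last by ring.
rewrite normrN !normrM (ger0_norm x0) mulrA [leRHS]mulrC -mulrA ler_wpM2l//.
apply: (@le_trans _ _ (2 * eta * (K * d ^+ 2))).
  by rewrite ler_pM// lipschitz_taylor.
by rewrite le_eqVlt; apply/predU1P; left; ring.
Qed.
End SteinBound.

(** * The normal density and Mills' ratio *)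

Section Gaussian.
Variable R : realType.
Local Notation phi := (normal_pdf (0 : R) 1).

Lemma normal_pdf01E x : phi x = normal_peak 1 * expR (- x ^+ 2 / 2).
Proof.
rewrite normal_pdfE ?oner_neq0//.
by rewrite -[LHS]/(normal_peak 1 * normal_fun 0 1 x) /normal_fun subr0 expr1n.
Qed.

Lemma normal_pdf01_gt0 x : 0 < phi x.
Proof. by rewrite normal_pdf01E mulr_gt0 ?expR_gt0// normal_peak_gt0 ?oner_neq0. Qed.

Lemma normal_pdf01N x : phi (- x) = phi x.
Proof. by rewrite !normal_pdf01E sqrrN. Qed.

Lemma is_derive_normal_pdf01 (x : R) : is_derive x 1 phi (- x * phi x).
Proof.
rewrite (_ : phi = fun x => normal_peak 1 * expR (- x ^+ 2 / 2)); last first.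
  by apply/funext => ?; exact: normal_pdf01E.
by apply: is_derive_eq; rewrite /GRing.scale/=; field.
Qed.

Lemma normal_pdf01_le x : phi x <= normal_peak 1.
Proof. exact: normal_pdf_ub (oner_neq0 _). Qed.

Lemma cvg_mul_normal_pdf01_Ny (q : R -> R) : (forall x, x < 0 -> `|q x| <= (- x)^-1) ->
  q x * phi x @[x --> -oo] --> (0 : R).
Proof.
move=> qx; apply/cvgrPdist_le => e e0; near=> x.
have p0 : 0 < normal_peak 1 :> R by rewrite normal_peak_gt0 ?oner_neq0.
have x0 : x < 0 by near: x; apply: nbhs_ninfty_lt; exact: num_real.
have xe : x <= - (normal_peak 1 / e) by near: x; apply: nbhs_ninfty_le; exact: num_real.
rewrite sub0r normrN normrM (ger0_norm (ltW (normal_pdf01_gt0 x))).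
apply: (@le_trans _ _ ((- x)^-1 * normal_peak 1)).
  by rewrite ler_pM ?normal_pdf01_le ?qx// ltW// normal_pdf01_gt0.
rewrite mulrC ler_pdivrMr ?oppr_gt0// mulrC -ler_pdivrMr//; lra.
Unshelve. all: by end_near. Qed.

(** Any antiderivative of the normal density that vanishes at [-oo] satisfies the
    classical bounds on Mills' ratio: the difference of the two sides vanishes at
    [-oo] and has a derivative of constant sign. They are stated for an arbitrary
    antiderivative to serve for both tails of the distribution function. *)
Section Mills.
Variable F : R -> R.
Hypothesis Fphi : forall x : R, is_derive x 1 F (phi x).
Hypothesis F0 : F x @[x --> -oo] --> (0 : R).

Lemma mills_upper x : x < 0 -> - x * F x <= phi x.
Proof.
move=> x0.
have H (z : R) : z < 0 -> is_derive z 1 (fun z => - z^-1 * phi z - F z) (phi z / z ^+ 2).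
  move=> z0; have z_neq0 : z != 0 by rewrite lt_eqF.
  have ? := is_derive_normal_pdf01 z.
  have ? := @is_deriveV _ _ _ _ _ z_neq0 (is_derive_id z 1).
  apply: is_derive_eq; rewrite /GRing.scale/=; field => //.
have : 0 <= - x^-1 * phi x - F x.
  apply: (ge0_of_derive_Ny H) x0.
    by move=> z z0; rewrite divr_ge0 ?sqr_ge0// ltW// normal_pdf01_gt0.
  rewrite -[X in _ --> X](subr0 0); apply: cvgB => //.
  apply: cvg_mul_normal_pdf01_Ny => z z0.
  by rewrite normrN normfV ltr0_norm.
by rewrite subr_ge0 -invrN [_ * phi x]mulrC ler_pdivlMr ?oppr_gt0// mulrC.
Qed.

Lemma mills_lower x : x < 0 -> - x / (1 + x ^+ 2) * phi x <= F x.
Proof.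
move=> x0; rewrite -subr_ge0.
have sq (z : R) : 0 < 1 + z ^+ 2 by rewrite ltr_pwDl ?sqr_ge0.
have H (z : R) : z < 0 -> is_derive z 1 (fun z => F z - - z / (1 + z ^+ 2) * phi z)
    (2 / (1 + z ^+ 2) ^+ 2 * phi z).
  move=> z0; have z_neq0 : 1 + z ^+ 2 != 0 by rewrite gt_eqF.
  have ? := is_derive_normal_pdf01 z.
  have h1 : is_derive z 1 (fun z => 1 + z ^+ 2 : R) (2 * z).
    by apply: is_derive_eq; rewrite /GRing.scale/=; ring.
  have ? := @is_deriveV _ (fun z => 1 + z ^+ 2) z _ _ z_neq0 h1.
  apply: is_derive_eq; rewrite /GRing.scale/=; field => //.
apply: (ge0_of_derive_Ny H) x0.
  by move=> z z0; rewrite mulr_ge0 ?divr_ge0 ?sqr_ge0// ltW// normal_pdf01_gt0.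
rewrite -[X in _ --> X](subr0 0); apply: cvgB => //.
apply: cvg_mul_normal_pdf01_Ny => z z0.
rewrite normrM normrN normfV (ltr0_norm z0) (gtr0_norm (sq z)).
rewrite ler_pdivrMr// -ler_pdivrMl ?invr_gt0 ?oppr_gt0// invrK; have := sqr_ge0 z; nra.
Qed.

(** With [f := F / phi] one has [f' x = x * f x + 1]: the last bound controls
    [x * f' x], the part of the derivative of [x * f x] that is not [f]. *)
Lemma mills_bounds (x : R) : x <= -1 ->
  let f := F x / phi x in
  [/\ `|f| <= 1, `|x * f| <= 1 & `|x * (x * f + 1)| <= 1].
Proof.
move=> x1 f; have x0 : x < 0 by lra.
have p0 := normal_pdf01_gt0 x.
have u : - x * f <= 1 by rewrite mulrA ler_pdivrMr ?mul1r ?mills_upper.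
have l : - x / (1 + x ^+ 2) <= f by rewrite ler_pdivlMr ?mills_lower.
have f0 : 0 <= f.
  by rewrite (le_trans _ l)// divr_ge0// ?addr_ge0 ?sqr_ge0//; lra.
have sq : 0 < 1 + x ^+ 2 by rewrite ltr_pwDl ?sqr_ge0.
rewrite ler_pdivrMr// in l.
split; rewrite ler_norml; apply/andP; split; nra.
Qed.
End Mills.
End Gaussian.

(** * Stein's equation for the normal distribution *)

Section NormalCdf.
Variable R : realType.
Local Notation phi := (normal_pdf (0 : R) 1).
Local Notation mu := (@lebesgue_measure R).

Definition weighted_cdf (h : R -> R) (x : R) : R :=
  (\int[mu]_(t in `]-oo, x]) (h t * phi t))%R.

Lemma is_derive_weighted_cdf (h : R -> R) :
  continuous h -> (forall t, `|h t| <= 1) ->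
  forall x : R, is_derive x 1 (weighted_cdf h) (h x * phi x).
Proof.
move=> ch h1 x.
have cphi : continuous phi := is_derive_continuous (@is_derive_normal_pdf01 R).
have chphi : continuous (fun t => h t * phi t).
  by move=> t; apply: continuousM; [exact: ch|exact: cphi].
have int : mu.-integrable `]-oo, x + 1] (EFin \o (fun t => h t * phi t)).
  apply: (@integrableS _ _ _ mu setT) => //.
  apply: le_integrable (integrable_normal_pdf (0 : R) 1) => //.
    by apply/measurable_EFinP; exact: continuous_measurable_fun.
  move=> t _ /=; rewrite lee_fin normrM ler_piMl//.
have [] := @continuous_FTC1 R (fun t => h t * phi t) -oo%O x (x + 1) _ int _ (chphi x).
- by rewrite ltrDl.
- by rewrite ltNyr.
by move=> d dE; split=> //; rewrite -derive1E.
Qed.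

Definition normal_cdf (x : R) : R := fine (normal_prob 0 1 `]-oo, x]).

Lemma normal_cdfE x : (normal_cdf x)%:E = normal_prob 0 1 `]-oo, x].
Proof. by rewrite /normal_cdf fineK// fin_num_measure. Qed.

Lemma normal_cdf_weighted x : normal_cdf x = weighted_cdf (cst 1) x.
Proof. by apply: eq_Rintegral => t _; rewrite mul1r. Qed.

Lemma is_derive_normal_cdf (x : R) : is_derive x 1 normal_cdf (phi x).
Proof.
rewrite (_ : normal_cdf = weighted_cdf (cst 1)); last first.
  by apply/funext => t; exact: normal_cdf_weighted.
rewrite -[phi x]mul1r; apply: is_derive_weighted_cdf => [t|t].
  exact: cst_continuous.
by rewrite normr1.
Qed.

Lemma normal_cdf_ge0 x : 0 <= normal_cdf x.
Proof. by rewrite fine_ge0. Qed.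

Lemma normal_cdf_le1 x : normal_cdf x <= 1.
Proof. by rewrite -lee_fin normal_cdfE probability_le1. Qed.

(* [normal_cdf] is the distribution function of the identity. *)
Let idTR : measurableTypeR R -> R := idfun.

#[local] HB.instance Definition _ :=
  @isMeasurableFun.Build _ _ _ _ idTR (@measurable_id _ _ setT).

Let idRV : {RV (normal_prob (0 : R) 1) >-> R} := idTR.

Lemma cvg_normal_cdfNy : normal_cdf x @[x --> -oo] --> (0 : R).
Proof.
have := cvg_cdfNy0 idRV; move/fine_cvg; exact.
Qed.

Lemma cvg_normal_cdfy : normal_cdf x @[x --> +oo] --> (1 : R).
Proof.
have := cvg_cdfy1 idRV; move/fine_cvg; exact.
Qed.

(** Stein's equation [f' w - w * f w = h w - c], where [h] decreases linearly from
    1 to 0 between [x] and [y], and [c] is the mean of [h] under the standard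
    normal distribution. The solution is [f = (H - c * Phi) / phi] with [H] the
    antiderivative of [h * phi]. Below [x] it equals [(1 - c) * Phi / phi], above
    [y] it equals [c * (1 - Phi) / phi], so that Mills' ratio bounds [f'] and the
    derivative of [w * f w] on both tails; continuity bounds them in between.
    Hence [f' = w * f w + h w - c] is bounded and Lipschitz. The final estimate
    holds because [h] and [c] lie between the values of the indicators and of the
    distribution function that belong to [x] and [y]. *)
Lemma stein_solution (x y : R) : x < y ->
  exists f df : R -> R, exists B K : R,
  [/\ forall w : R, is_derive w 1 f (df w),
      forall w, `|df w| <= B,
      forall v w, `|df v - df w| <= K * `|v - w| &
      forall w : R, (w <= x)%R%:R - normal_cdf y <= df w - w * f w
                <= (w <= y)%R%:R - normal_cdf x].
Proof.
move=> xy; have yx0 : 0 < y - x by rewrite subr_gt0.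
(* a formula without case distinction makes continuity immediate *)
pose h w : R := (1 + (`|y - w| - `|w - x|) / (y - x)) / 2.
have hx w : w <= x -> h w = 1.
  move=> wx; have wy := le_trans wx (ltW xy).
  rewrite /h ger0_norm ?subr_ge0// ler0_norm ?subr_le0//.
  by field; rewrite gt_eqF.
have hy w : y <= w -> h w = 0.
  move=> yw; have xw := le_trans (ltW xy) yw.
  rewrite /h ler0_norm ?subr_le0// ger0_norm ?subr_ge0//.
  by field; rewrite gt_eqF.
have h01 w : 0 <= h w <= 1.
  have : `| `|y - w| - `|w - x| | <= y - x.
    rewrite (distrC w x) (le_trans (ler_dist_dist _ _))//.
    by rewrite opprB addrA addrNK ger0_norm// ltW.
  rewrite -[leRHS]mul1r -ler_pdivrMr// -[X in _ / X]gtr0_norm// -normfV -normrM.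
  by rewrite ler_norml /h; lra.
have hK v w : `|h v - h w| <= (y - x)^-1 * `|v - w|.
  have h1 := ler_dist_dist (y - v) (y - w).
  have h2 := ler_dist_dist (w - x) (v - x).
  rewrite (_ : y - v - (y - w) = - (v - w)) in h1; last by ring.
  rewrite (_ : w - x - (v - x) = - (v - w)) in h2; last by ring.
  rewrite (_ : h v - h w = (y - x)^-1 *
    (((`|y - v| - `|y - w|) + (`|w - x| - `|v - x|)) / 2)); last first.
    by rewrite /h; field; rewrite gt_eqF.
  rewrite normrM normfV (gtr0_norm yx0) ler_wpM2l ?invr_ge0 ?(ltW yx0)//.
  rewrite normrM normfV [`|2|]ger0_norm// ler_pdivrMr//.
  rewrite (le_trans (ler_normD _ _))// mulr_natr mulr2n lerD// -[leRHS]normrN//.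
have ch : continuous h.
  move=> w; apply: cvgM; last exact: cvg_cst.
  apply: cvgD; first exact: cvg_cst.
  by apply: cvgM; last exact: cvg_cst; apply: cvgB; apply: cvg_norm; apply: cvgB;
    (exact: cvg_cst || exact: cvg_id).
pose H := weighted_cdf h; pose Phi := normal_cdf; pose c := H y.
have hle1 t : `|h t| <= 1 by rewrite ler_norml; have := h01 t; lra.
have dH : forall w : R, is_derive w 1 H (h w * phi w) by exact: is_derive_weighted_cdf.
have dPhi := is_derive_normal_cdf.
have phi0 w : 0 < phi w := normal_pdf01_gt0 w.
have Hx w : w <= x -> H w = Phi w.
  move=> wx; rewrite /Phi normal_cdf_weighted; apply: eq_Rintegral => t.
  by rewrite inE/= in_itv/= => tw; rewrite hx// (le_trans tw).
have Hy w : y <= w -> H w = c.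
  move=> yw; have [|xi] := @MVT_segment _ H _ _ _ yw (fun z _ => dH z).
    by apply: continuous_subspaceT; exact: is_derive_continuous dH.
  rewrite in_itv/= => /andP[yxi _]; rewrite hy// !mul0r => /eqP.
  by rewrite subr_eq0 => /eqP.
have c_ge : Phi x <= c.
  rewrite -(Hx x)// -subr_ge0; have [xi _ ->] := MVT_real dH x y.
  by rewrite mulr_ge0 ?(ltW yx0)// mulr_ge0 ?(ltW (phi0 _))//; case/andP: (h01 xi).
have c_le : c <= Phi y.
  have dPH (w : R) : is_derive w 1 (fun t => Phi t - H t) ((1 - h w) * phi w).
    have ? := dH w; have ? := dPhi w.
    by apply: is_derive_eq; rewrite mulrBl mul1r.
  have [xi _] := MVT_real dPH x y; rewrite (Hx x)// subrr subr0 -/c => e.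
  rewrite -subr_ge0 e mulr_ge0 ?(ltW yx0)// mulr_ge0 ?(ltW (phi0 _))//.
  by rewrite subr_ge0; case/andP: (h01 xi).
have c0 : 0 <= c by rewrite (le_trans _ c_ge)// normal_cdf_ge0.
have c1 : c <= 1 by rewrite (le_trans c_le)// normal_cdf_le1.
pose f w := (H w - c * Phi w) / phi w; pose df w := w * f w + h w - c.
have fdf (w : R) : is_derive w 1 f (df w).
  have ? := dH w; have ? := dPhi w; have ? := is_derive_normal_pdf01 w.
  have pw : phi w != 0 by rewrite gt_eqF.
  by apply: is_derive_eq; rewrite /df /f /GRing.scale/=; field.
have cf := is_derive_continuous fdf.
have cont_df : continuous df.
  move=> w; apply: cvgB; last exact: cvg_cst.
  by apply: cvgD; [apply: cvgM; [exact: cvg_id|exact: cf]|exact: ch].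
pose e w := f w + w * df w.
have de (w : R) : is_derive w 1 (fun t => t * f t) (e w).
  have ? := fdf w.
  by apply: is_derive_eq; rewrite /e /GRing.scale/=; ring.
have ce : continuous e.
  move=> w; apply: cvgD; first exact: cf.
  by apply: cvgM; [exact: cvg_id|exact: cont_df].
have left w : w <= Num.min x (-1) -> `|df w| <= 2 /\ `|e w| <= 2.
  rewrite le_min => /andP[wx w1].
  have [g1 g2 g3] := mills_bounds dPhi cvg_normal_cdfNy w1.
  set g := _ / _ in g1 g2 g3.
  have fE : f w = (1 - c) * g by rewrite /f /g Hx// /Phi; ring.
  have -> : df w = (1 - c) * (w * g + 1) by rewrite /df fE hx//; ring.
  have {}cc : `|1 - c| <= 1 by rewrite ler_norml; lra.
  have -> : e w = (1 - c) * (g + w * (w * g + 1)) by rewrite /e /df fE hx//; ring.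
  split; rewrite normrM -[leRHS]mul1r ler_pM//.
    by rewrite (le_trans (ler_normD _ _))// normr1 (_ : 2 = 1 + 1 :> R)// lerD.
  by rewrite (le_trans (ler_normD _ _))// (_ : 2 = 1 + 1 :> R)// lerD.
have right w : Num.max y 1 <= w -> `|df w| <= 2 /\ `|e w| <= 2.
  rewrite ge_max => /andP[yw w1].
  pose G t := 1 - Phi (- t).
  have dG (t : R) : is_derive t 1 G (phi t).
    have ? := dPhi (- t).
    have ? : is_derive t 1 (fun t => Phi (- t)) (- phi (- t)).
      have ? : is_derive t 1 (-%R : R -> R) (- 1) by exact: is_deriveN.
      by rewrite -[- phi (- t)]mulrN1; exact: (@is_derive1_comp R Phi -%R t).
    by apply: is_derive_eq; rewrite normal_pdf01N opprK add0r mul1r.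
  have G0 : G t @[t --> -oo] --> (0 : R).
    rewrite -[X in _ --> X](subrr 1); apply: cvgB; first exact: cvg_cst.
    by apply/cvgNy_compNP; under eq_fun do rewrite /= opprK; exact: cvg_normal_cdfy.
  have w1' : - w <= -1 by rewrite lerN2.
  have [g1 g2 g3] := mills_bounds dG G0 w1'.
  set g := _ / _ in g1 g2 g3.
  have fE : f w = c * g by rewrite /f /g Hy// normal_pdf01N /G opprK; ring.
  have -> : df w = c * (- (- w * g) - 1) by rewrite /df fE hy//; ring.
  have {}cc : `|c| <= 1 by rewrite ler_norml; lra.
  have -> : e w = c * (g + - w * (- w * g + 1)) by rewrite /e /df fE hy//; ring.
  split; rewrite normrM -[leRHS]mul1r ler_pM//.
    by rewrite (le_trans (ler_normB _ _))// normrN normr1 (_ : 2 = 1 + 1 :> R)// lerD.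
  by rewrite (le_trans (ler_normD _ _))// (_ : 2 = 1 + 1 :> R)// lerD.
have [B dfB] := continuous_bounded cont_df (fun w wl => (left w wl).1)
  (fun w wr => (right w wr).1).
have [C eC] := continuous_bounded ce (fun w wl => (left w wl).2)
  (fun w wr => (right w wr).2).
exists f, df, B, (C + (y - x)^-1); split => //.
  move=> v w; rewrite (_ : _ - _ = (v * f v - w * f w) + (h v - h w)); last first.
    by rewrite /df; ring.
  rewrite (le_trans (ler_normD _ _))// mulrDl lerD//.
  exact: (lipschitz_of_derive de eC).
move=> w; rewrite (_ : df w - w * f w = h w - c); last by rewrite /df; ring.
have /andP[hw0 hw1] := h01 w.
apply/andP; split; apply: lerB => //.
  by have [/hx ->|] := leP w x.
by have [|/ltW/hy ->] := leP w y.
Qed.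
End NormalCdf.

(** * The central limit theorem for sampling without replacement *)

Section FinitePopulationCLT.
Variable R : realType.

(** By [mean_sample_sum_sq], the second condition says that the sampling sum has
    variance 1. *)
Definition standardized (N m : nat) (a : 'I_N -> R) (eta : R) : Prop :=
  [/\ \sum_i a i = 0, pair_rate R N m * \sum_i a i ^+ 2 = 1 &
      forall i, `|a i| <= eta].

(** The Stein solution for [x < y] dominates [1_(w <= x)] minus the distribution
    function at [y], and is dominated by [1_(w <= y)] minus the distribution
    function at [x]; its mean is small by [stein_bound]. *)
Lemma sandwich_clt (x y e : R) : x < y -> 0 < e ->
  exists2 eta : R, 0 < eta & forall (N m : nat) (a : 'I_N -> R),
    (1 < N)%N -> (m <= N)%N -> 2 / N%:R <= eta -> standardized m a eta ->
    mean m (fun g => (sample_sum a g <= x)%R%:R) <= normal_cdf y + e /\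
    normal_cdf x - e <= mean m (fun g => (sample_sum a g <= y)%R%:R).
Proof.
move=> xy e0; have [f [df [B [K [fdf dfB dfK fle]]]]] := stein_solution xy.
have B0 : 0 <= B by exact: le_trans (dfB 0).
have K0 : 0 <= K.
  have := dfK 1 0; rewrite subr0 normr1 mulr1; exact: le_trans.
have D0 : 0 < 2 * B + 2 * K + 1 by lra.
(* once [2 / N <= eta], the bound of [stein_bound] is at most [2 * (B + K) * eta] *)
exists (e / (2 * B + 2 * K + 1)); first exact: divr_gt0.
set eta := e / _ => N m a N2 mN N_eta [a0 a1 a_eta].
have eta0 : 0 < eta by exact: divr_gt0.
have etaE : (2 * B + 2 * K + 1) * eta = e by rewrite mulrC divfK// gt_eqF.
have := stein_bound N2 mN a0 a1 eta0 a_eta fdf dfB dfK.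
set M := mean m (fun g => _ - _) => M_le.
have {}M_le : `|M| <= e.
  apply: (le_trans M_le); rewrite -etaE.
  have : B * (eta / 2 + 2 / N%:R) <= B * (2 * eta) by rewrite ler_wpM2l//; lra.
  by move=> ?; nra.
move: M_le; rewrite ler_norml => /andP[M1 M2]; split.
  have : mean m (fun g => (sample_sum a g <= x)%R%:R) - normal_cdf y <= M.
    rewrite -[normal_cdf y](mean_cst _ mN) -meanB.
    by apply: le_mean => g _; case/andP: (fle (sample_sum a g)).
  by lra.
have : M <= mean m (fun g => (sample_sum a g <= y)%R%:R) - normal_cdf x.
  rewrite -[normal_cdf x](mean_cst _ mN) -meanB.
  by apply: le_mean => g _; case/andP: (fle (sample_sum a g)).
by lra.
Qed.

(** A central limit theorem for simple random sampling, uniform in the population: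
    the distribution function of a standardized sum is close to the normal one as
    soon as all weights are small and the population is large. *)
Lemma finite_population_clt (x e : R) : 0 < e ->
  exists2 eta : R, 0 < eta & forall (N m : nat) (a : 'I_N -> R),
    (1 < N)%N -> (m <= N)%N -> 2 / N%:R <= eta -> standardized m a eta ->
    `|normal_cdf x - mean m (fun g => (sample_sum a g <= x)%R%:R)| <= e.
Proof.
move=> e0; have e20 : 0 < e / 2 by rewrite divr_gt0.
have /cvgrPdist_le/(_ _ e20)[d /= d0 dPhi] :
  {for x, continuous (@normal_cdf R)}.
  exact: is_derive_continuous (@is_derive_normal_cdf R) x.
have near_x y : `|x - y| < d -> `|normal_cdf x - normal_cdf y| <= e / 2 by exact: dPhi.
have xd : x < x + d / 2 by lra.
have dx : x - d / 2 < x by lra.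
have [eta1 eta1_gt0 up] := sandwich_clt xd e20.
have [eta2 eta2_gt0 lo] := sandwich_clt dx e20.
exists (Num.min eta1 eta2); first by rewrite lt_min eta1_gt0.
move=> N m a N2 mN; rewrite le_min => /andP[N1 N2'] [a0 a1 aeta].
have [|{}up _] := up N m a N2 mN N1.
  by split=> // i; have := aeta i; rewrite le_min => /andP[].
have [|_ {}lo] := lo N m a N2 mN N2'.
  by split=> // i; have := aeta i; rewrite le_min => /andP[].
have n1 : `|normal_cdf x - normal_cdf (x - d / 2)| <= e / 2.
  by apply: near_x; rewrite ltr_norml; apply/andP; split; lra.
have n2 : `|normal_cdf x - normal_cdf (x + d / 2)| <= e / 2.
  by apply: near_x; rewrite ltr_norml; apply/andP; split; lra.
move: n1 n2; rewrite !ler_norml => /andP[n1 n2] /andP[n3 n4].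
by apply/andP; split; lra.
Qed.
End FinitePopulationCLT.

(** * Expectation, variance and distribution function under the permutation null *)

Section PermNull.
Variables (R : realType) (N m : nat) (le_mN : (m <= N)%N).
Local Notation P := (perm_null R le_mN).

Lemma perm_null_mean (A : set (labelling N)) :
  P A = (mean m (fun g => \1_A g))%:E.
Proof.
rewrite /perm_null /mean mulr_sumr -sumEFin; apply: eq_bigr => g _.
by rewrite EFinM diracE.
Qed.

(** Enumerating the labellings turns the distribution into a finite sum of scaled
    Dirac masses indexed by natural numbers, which is integrated term by term. *)
Lemma ge0_integral_perm_null (F : labelling N -> R) : (forall g, 0 <= F g) ->
  (\int[P]_g (F g)%:E = (mean m F)%:E)%E.
Proof.
move=> F0.
pose c : {nonneg R} := NngNum (eqbRL (invr_ge0 'C(N, m)%:R) (ler0n R _)).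
pose s := enum (choices N m); pose g0 : labelling N := [ffun=> false].
pose m_ (n : nat) := mscale c (\d_(nth g0 s n) : {measure set (labelling N) -> \bar R}).
rewrite (@eq_measure_integral _ _ _ setT (msum m_ (size s))); last first.
  move=> A _ _; rewrite /msum/= /perm_null.
  by rewrite -big_enum/= (big_nth g0) big_mkord.
rewrite ge0_integral_measure_sum//; last by move=> g _; rewrite lee_fin.
rewrite /mean mulr_sumr -sumEFin -[RHS]big_enum/= [RHS](big_nth g0) [RHS]big_mkord.
apply: eq_bigr => i _; rewrite ge0_integral_mscale//; last by move=> g _; rewrite lee_fin.
by rewrite integral_dirac// diracT mul1e EFinM.
Qed.

Lemma expectation_perm_null (F : labelling N -> R) :
  ('E_P[F] = (mean m F)%:E)%E.
Proof.
rewrite unlock integralE.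
under eq_integral do rewrite funeposE -EFin_max.
under [X in (_ - X)%E]eq_integral do rewrite funenegE -EFinN -EFin_max.
rewrite !ge0_integral_perm_null; try by move=> g; rewrite le_max lexx orbT.
rewrite -EFinB -meanB; congr _%:E; apply: eq_mean => g _.
by rewrite /Num.max; case: (ltP (F g) 0) => ?; case: (ltP (- F g) 0) => ?; lra.
Qed.

Lemma variance_perm_null (F : labelling N -> R) :
  ('V_P[F] = (mean m (fun g => (F g - mean m F) ^+ 2))%:E)%E.
Proof.
rewrite /variance unlock !expectation_perm_null.
by congr _%:E; apply: eq_mean => g _; rewrite expr2.
Qed.

Lemma cdf_perm_null (X : {RV P >-> R}) (x : R) :
  cdf X x = (mean m (fun g => (X g <= x)%R%:R))%:E.
Proof.
rewrite -[cdf X x]/(P (X @^-1` `]-oo, x])) perm_null_mean; congr _%:E.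
apply: eq_mean => g _; rewrite indicE; congr (_%:R); congr nat_of_bool.
by apply/idP/idP; rewrite inE/= in_itv.
Qed.
End PermNull.

(** * The statistic as a sampling sum of centered degrees *)

Section Graph.
Variables (R : realType) (N : nat) (G : {set {set 'I_N}}).
Hypothesis simpleG : simple_graph G.

Lemma sum_edges_at (F : 'I_N -> R) :
  \sum_(e in G) \sum_(i in e) F i = \sum_i #|edges_at G i|%:R * F i.
Proof.
rewrite (exchange_big_dep predT)//=; apply: eq_bigr => i _.
rewrite sumr_const -[LHS]mulr_natl; congr (_%:R * _).
by apply: eq_card => e; rewrite !inE.
Qed.

(** An edge with endpoints [a] and [b] contributes 1, 0 or -1 to the statistic,
    which is [g a + g b - 1]. *)
Lemma Rdiff_degree (g : labelling N) :
  Rdiff R G g = sample_sum (fun i => #|edges_at G i|%:R) g - #|G|%:R.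
Proof.
rewrite /sample_sum -sum_edges_at -sum1_card natr_sum -sumrB.
have within j : (edges_within G j g)%:R =
    \sum_(e in G) [forall i in e, g i == j]%:R :> R.
  rewrite /edges_within -sum1_card natr_sum big_mkcond [RHS]big_mkcond/=.
  by apply: eq_bigr => e _; rewrite inE; case: (e \in G) => //=; case: ifP.
rewrite /Rdiff !within -sumrB; apply: eq_bigr => e /simpleG/eqP/cards2P[a [b [ab ->]]].
rewrite big_setU1 ?inE//= big_set1.
have forallE j : [forall i in [set a; b]%SET, g i == j] = (g a == j) && (g b == j).
  apply/forall_inP/andP => [gj|[ga gb] i].
    by split; apply: gj; rewrite !inE eqxx ?orbT.
  by rewrite !inE => /orP[] /eqP ->.
by rewrite !forallE; case: (g a); case: (g b); rewrite /=; ring.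
Qed.

Lemma sum_centered_degree : (0 < N)%N -> \sum_i centered_degree R G i = 0.
Proof.
move=> N0; rewrite sumrB sumr_const card_ord -[_ *+ N]mulr_natr.
rewrite divfK ?pnatr_eq0 -?lt0n//.
under eq_bigr do rewrite -[_%:R]mulr1.
rewrite -sum_edges_at (eq_bigr (fun=> 2)).
  by rewrite sumr_const mulr_natr subrr.
by move=> e /simpleG e2; rewrite sumr_const e2.
Qed.

(** The number of sampled nodes is fixed, so that centering the degrees only
    shifts the statistic. *)
Lemma Rdiff_centered_degree (m : nat) : exists k : R,
  {in choices N m, forall g,
     Rdiff R G g = sample_sum (centered_degree R G) g + k}.
Proof.
exists (2 * #|G|%:R / N%:R * m%:R - #|G|%:R) => g gm.
rewrite Rdiff_degree addrA; congr (_ - _).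
rewrite -(choices_sum R gm) mulr_sumr -big_split/=; apply: eq_bigr => i _.
by rewrite /centered_degree; ring.
Qed.

Lemma Zdiff_sample_sum (m : nat) (le_mN : (m <= N)%N) : (1 < N)%N ->
  {in choices N m, forall g, Zdiff R le_mN G g = sample_sum (fun i =>
    centered_degree R G i / Num.sqrt (pair_rate R N m * VG R G)) g}.
Proof.
move=> N2; have d0 := sum_centered_degree (ltnW N2).
have [k RE] := Rdiff_centered_degree m.
have meanR : mean m (Rdiff R G) = k.
  rewrite (eq_mean RE) meanD mean_cst//.
  (* the centered sum has mean 0: [mean_sample_sum_mul] with a constant function *)
  rewrite (_ : mean _ _ = 0) ?add0r//.
  have := mean_sample_sum_mul m N2 (fun=> 1) d0.
  rewrite (@eq_mean _ _ _ _ (sample_sum (centered_degree R G))); last first.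
    by move=> g _; rewrite mulr1.
  move=> ->; rewrite (@eq_mean _ _ _ _ (fun=> 0)) ?mean_cst// => g _.
  rewrite big1 ?mulr0// => i _; rewrite big1// => j _.
  by rewrite subrr mulr0.
move=> g gm; rewrite /Zdiff expectation_perm_null variance_perm_null/= meanR.
rewrite RE// addrK (@eq_mean _ _ _ _ (fun g => sample_sum (centered_degree R G) g ^+ 2)).
  by rewrite mean_sample_sum_sq// mulr_suml; apply: eq_bigr => i _; rewrite mulrAC.
by move=> h hm; rewrite RE// addrK.
Qed.

Lemma sq_centered_degree_le_max i :
  centered_degree R G i ^+ 2 <= max_sq_centered_degree R G.
Proof. exact: le_bigmax. Qed.
End Graph.

(** * Asymptotics *)

Lemma pair_rate_ge (R : realType) (N m : nat) : (1 < N)%N -> (m <= N)%N ->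
  m%:R / N%:R * (1 - m%:R / N%:R) <= pair_rate R N m.
Proof.
move=> N2 mN; have N0 : 0 < N%:R :> R by rewrite ltr0n ltnW.
have N1 : 0 < N%:R - 1 :> R by rewrite subr_gt0 ltr1n.
have mN' : 0 <= m%:R * (N%:R - m%:R) :> R by rewrite mulr_ge0 ?subr_ge0 ?ler_nat.
rewrite (_ : _ * (1 - _) = m%:R * (N%:R - m%:R) / (N%:R * N%:R)); last first.
  by field; rewrite gt_eqF.
rewrite /pair_rate ler_wpM2l// lef_pV2 ?posrE ?mulr_gt0// ler_wpM2l ?(ltW N0)//.
by rewrite gerBl.
Qed.

(** The limit of [pair_rate] is [r * (1 - r)], so that the variance of [Rdiff] is at
    least a fixed fraction of [VG], and weights that are negligible with respect
    to [VG] remain so after standardization. *)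
Lemma near_pair_rate_gt (R : realType) (r : R) (m : nat -> nat) : 0 < r < 1 ->
  (forall N, (m N <= N)%N) -> (m N)%:R / N%:R @[N --> \oo] --> r ->
  exists2 rho : R, 0 < rho & \forall N \near \oo, rho < pair_rate R N (m N).
Proof.
move=> /andP[r0 r1] mN m_ratio; exists (r * (1 - r) / 2).
  by rewrite divr_gt0// mulr_gt0// subr_gt0.
have lim : (m N)%:R / N%:R * (1 - (m N)%:R / N%:R) @[N --> \oo] --> r * (1 - r).
  by apply: cvgM => //; apply: cvgB => //; exact: cvg_cst.
have rho : r * (1 - r) / 2 < r * (1 - r).
  have : 0 < r * (1 - r) by rewrite mulr_gt0// subr_gt0.
  by lra.
near=> N; apply: (@lt_le_trans _ _ ((m N)%:R / N%:R * (1 - (m N)%:R / N%:R))).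
  by near: N; exact: cvgr_gt lim _ rho.
apply: pair_rate_ge => //; near: N; exact: nbhs_infty_gt.
Unshelve. all: by end_near. Qed.

Lemma near_two_div_le (R : realType) (e : R) : 0 < e ->
  \forall N \near \oo, 2 / N%:R <= e.
Proof.
move=> e0; near=> N; have N0 : 0 < N%:R :> R.
  by rewrite ltr0n; near: N; exact: nbhs_infty_gt.
rewrite ler_pdivrMr// -ler_pdivrMl//; near: N; exact: nbhs_infty_ger.
Unshelve. all: by end_near. Qed.

Theorem theorem5 (R : realType) (r : R) (m : nat -> nat)
    (G : forall N : nat, {set {set 'I_N}})
    (r01 : 0 < r < 1)
    (le_mN : forall N : nat, (m N <= N)%N)
    (m_ratio : (m N)%:R / N%:R @[N --> \oo] --> r)
    (simpleG : forall N : nat, simple_graph (G N))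
    (max_littleo : ratio_littleo (fun N => max_sq_centered_degree R (G N))
                                 (fun N => VG R (G N))) :
  cvg_in_distribution
    (P := fun N => perm_null R (le_mN N))
    (fun N => Zdiff R (le_mN N) (G N))
    (normal_prob 0 1).
Proof.
move=> x _; rewrite [X in _ --> X](_ : _ = (normal_cdf x)%:E); last first.
  by rewrite normal_cdfE.
rewrite (_ : (fun N => cdf _ x) = fun N =>
    (mean (m N) (fun g => (Zdiff R (le_mN N) (G N) g <= x)%R%:R))%:E); last first.
  by apply/funext => N; exact: cdf_perm_null.
apply: cvg_EFin; first by near=> N.
apply/cvgrPdist_le => e e0.
have [eta eta0 clt] := finite_population_clt x e0.
have [rho rho0 rate_rho] := near_pair_rate_gt r01 le_mN m_ratio.
have [VG_neq0 max_VG] := max_littleo.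
have rho_eta : 0 < rho * eta ^+ 2 by rewrite mulr_gt0// exprn_gt0.
near=> N.
have N2 : (1 < N)%N by near: N; exact: nbhs_infty_gt.
set a := fun i => centered_degree R (G N) i /
  Num.sqrt (pair_rate R N (m N) * VG R (G N)).
have rate0 : rho < pair_rate R N (m N) by near: N.
have VG0 : 0 < VG R (G N).
  rewrite lt0r; apply/andP; split; first by near: N.
  by apply: sumr_ge0 => i _; exact: sqr_ge0.
have var0 : 0 < pair_rate R N (m N) * VG R (G N).
  by rewrite mulr_gt0// (lt_trans rho0).
have asq i : a i ^+ 2 =
    centered_degree R (G N) i ^+ 2 / (pair_rate R N (m N) * VG R (G N)).
  by rewrite exprMn exprVn sqr_sqrtr// ltW.
rewrite /= (eq_mean (F2 := fun g => (sample_sum a g <= x)%R%:R)); last first.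
  by move=> g gm; rewrite Zdiff_sample_sum.
apply: clt => //; first by near: N; exact: near_two_div_le.
split.
- by rewrite -mulr_suml sum_centered_degree ?mul0r// ltnW.
- under eq_bigr do rewrite asq.
  by rewrite -mulr_suml mulrA divff// gt_eqF.
move=> i; rewrite -(ler_pXn2r (n := 2))// ?nnegrE ?(ltW eta0)//.
rewrite real_normK ?num_real// asq ler_pdivrMr// mulrA.
rewrite (le_trans (sq_centered_degree_le_max _ _ _))// -ler_pdivrMr//.
apply: (@le_trans _ _ (rho * eta ^+ 2)); last first.
  by rewrite mulrC ler_wpM2l ?sqr_ge0// ltW.
near: N; exact: cvgr_le max_VG _ rho_eta.
Unshelve. all: by end_near. Qed.
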